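(* Let $\mathcal{M}=\mathbb{S}_{++}^n$. Consider either of the two mappings of tangent vectors $\xi\in T_\Sigma\mathcal{M}$: (a) $\xi'=\Sigma^{-1/2}\xi\Sigma^{-1/2}$, or (b) $\xi'=L^{-1}\xi L^{-\top}$ with $\Sigma=LL^\top$ the Cholesky decomposition. Under either mapping, for all $\Sigma_1,\Sigma_2\in\mathcal{M}$, both the mapped vector transport and the mapped adjoint vector transport are the identity, i.e. $\mathcal{T}'_{\Sigma_1,\Sigma_2}(\xi')=\xi'$ and $\mathcal{T}'^{*}_{\Sigma_1,\Sigma_2}(\eta')=\eta'$ for all mapped tangent vectors $\xi'$ at $\Sigma_1$ and $\eta'$ at $\Sigma_2$. Consequently both are isometric: they preserve inner products of mapped tangent vectors, i.e. $g'_{\Sigma_2}(\mathcal{T}'_{\Sigma_1,\Sigma_2}\xi',\mathcal{T}'_{\Sigma_1,\Sigma_2}\zeta')=g'_{\Sigma_1}(\xi',\zeta')$ and $g'_{\Sigma_1}(\mathcal{T}'^{*}_{\Sigma_1,\Sigma_2}\eta',\mathcal{T}'^{*}_{\Sigma_1,\Sigma_2}\theta')=g'_{\Sigma_2}(\eta',\theta')$ for all mapped tangent vectors $\xi',\zeta'$ at $\Sigma_1$ and $\eta',\theta'$ at $\Sigma_2$; and they preserve the lengths of mapped tangent vectors.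
   Context: $\mathcal{M}=\mathbb{S}_{++}^n$ is the manifold of real symmetric positive definite $n\times n$ matrices; each tangent space $T_\Sigma\mathcal{M}$ is identified with the space of real symmetric $n\times n$ matrices. The metric is $g_\Sigma(\xi,\eta)=\mathrm{tr}(\Sigma^{-1}\xi\Sigma^{-1}\eta)$. $\Sigma^{1/2}$ is the symmetric positive definite square root; in $\Sigma=LL^\top$, $L$ is lower triangular (with positive diagonal), and $L_1,L_2$ are the Cholesky factors of $\Sigma_1,\Sigma_2$. The vector transport $\mathcal{T}_{\Sigma_1,\Sigma_2}:T_{\Sigma_1}\mathcal{M}\to T_{\Sigma_2}\mathcal{M}$ is $\mathcal{T}_{\Sigma_1,\Sigma_2}(\xi)=\Sigma_2^{1/2}\Sigma_1^{-1/2}\xi\Sigma_1^{-1/2}\Sigma_2^{1/2}$ in case (a), and $\mathcal{T}_{\Sigma_1,\Sigma_2}(\xi)=L_2L_1^{-1}\xi L_1^{-\top}L_2^\top$ in case (b). The adjoint vector transport $\mathcal{T}^*_{\Sigma_1,\Sigma_2}:T_{\Sigma_2}\mathcal{M}\to T_{\Sigma_1}\mathcal{M}$ is defined by $g_{\Sigma_1}(\xi,\mathcal{T}^*_{\Sigma_1,\Sigma_2}\eta)=g_{\Sigma_2}(\mathcal{T}_{\Sigma_1,\Sigma_2}\xi,\eta)$ for all $\xi\in T_{\Sigma_1}\mathcal{M}$, $\eta\in T_{\Sigma_2}\mathcal{M}$. A primed tangent vector at $\Sigma$ is the image under the mapping at $\Sigma$ of the corresponding unprimed one. The mapped operators are: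 $g'_\Sigma(\xi',\eta'):=g_\Sigma(\xi,\eta)$; $\mathcal{T}'_{\Sigma_1,\Sigma_2}(\xi')$ is the image under the mapping at $\Sigma_2$ of $\mathcal{T}_{\Sigma_1,\Sigma_2}(\xi)$; $\mathcal{T}'^{*}_{\Sigma_1,\Sigma_2}(\eta')$ is the image under the mapping at $\Sigma_1$ of $\mathcal{T}^*_{\Sigma_1,\Sigma_2}(\eta)$. The length of a mapped tangent vector $\xi'$ at $\Sigma$ is $\sqrt{g'_\Sigma(\xi',\xi')}$. *)

(* Defs.v *)
From mathcomp Require Import all_boot all_order all_algebra.
From mathcomp Require Import boolp classical_sets functions reals.
Set Implicit Arguments.
Unset Strict Implicit.
Unset Printing Implicit Defensive.
Import Order.TTheory GRing.Theory Num.Theory.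
Local Open Scope classical_set_scope.
Local Open Scope ring_scope.

Definition SPD (R : realType) (n : nat) : set 'M[R]_n :=
  [set S | S \is symmetricmx /\
           forall x : 'cV[R]_n, x != 0 -> 0 < (x^T *m S *m x) 0 0].

(** The tangent space does not depend on the base point. *)
Definition tangent (R : realType) (n : nat) : set 'M[R]_n :=
  [set xi | xi \is symmetricmx].

Definition metric (R : realType) (n : nat) (S xi eta : 'M[R]_n) : R :=
  \tr (invmx S *m xi *m invmx S *m eta).

(** [sqrtmx S] and [cholesky S] are "the" matrix with the defining property,
    which exists and is unique when [S] is positive definite; the default
    value [0] is only taken when there is no such matrix. *)
Definition sqrtmx (R : realType) (n : nat) (S : 'M[R]_n) : 'M[R]_n :=
  xget 0 [set Q | SPD Q /\ Q *m Q = S].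

(** [is_trig_mx] is lower triangularity. *)
Definition cholesky (R : realType) (n : nat) (S : 'M[R]_n) : 'M[R]_n :=
  xget 0 [set L : 'M[R]_n |
    [/\ is_trig_mx L, forall i, 0 < L i i & L *m L^T = S]].

Inductive mapping_kind := SquareRoot | Cholesky.

Definition mapping (R : realType) (n : nat) (k : mapping_kind)
    (S xi : 'M[R]_n) : 'M[R]_n :=
  match k with
  | SquareRoot => invmx (sqrtmx S) *m xi *m invmx (sqrtmx S)
  | Cholesky => invmx (cholesky S) *m xi *m (invmx (cholesky S))^T
  end.

Definition transport (R : realType) (n : nat) (k : mapping_kind)
    (S1 S2 xi : 'M[R]_n) : 'M[R]_n :=
  match k with
  | SquareRoot =>
      sqrtmx S2 *m invmx (sqrtmx S1) *m xi *m invmx (sqrtmx S1) *m sqrtmx S2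
  | Cholesky =>
      cholesky S2 *m invmx (cholesky S1) *m xi
        *m (invmx (cholesky S1))^T *m (cholesky S2)^T
  end.

(** The adjoint is characterised by duality; the tangent vector is unique since
    the metric is nondegenerate. *)
Definition adjoint_transport (R : realType) (n : nat) (k : mapping_kind)
    (S1 S2 eta : 'M[R]_n) : 'M[R]_n :=
  xget 0 [set zeta | tangent zeta /\
    forall xi, tangent xi ->
      metric S1 xi zeta = metric S2 (transport k S1 S2 xi) eta].

Definition mapped_tangent (R : realType) (n : nat) (k : mapping_kind)
    (S : 'M[R]_n) : set 'M[R]_n :=
  mapping k S @` @tangent R n.

(** The unprimed tangent vector [xi] corresponding to a primed vector [xi']. *)
Definition unmapping (R : realType) (n : nat) (k : mapping_kind)
    (S : 'M[R]_n) : 'M[R]_n -> 'M[R]_n :=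
  'pinv_(fun=> 0) (@tangent R n) (mapping k S).

Definition mapped_metric (R : realType) (n : nat) (k : mapping_kind)
    (S xi' eta' : 'M[R]_n) : R :=
  metric S (unmapping k S xi') (unmapping k S eta').

Definition mapped_transport (R : realType) (n : nat) (k : mapping_kind)
    (S1 S2 xi' : 'M[R]_n) : 'M[R]_n :=
  mapping k S2 (transport k S1 S2 (unmapping k S1 xi')).

Definition mapped_adjoint_transport (R : realType) (n : nat)
    (k : mapping_kind) (S1 S2 eta' : 'M[R]_n) : 'M[R]_n :=
  mapping k S1 (adjoint_transport k S1 S2 (unmapping k S2 eta')).

Definition mapped_length (R : realType) (n : nat) (k : mapping_kind)
    (S xi' : 'M[R]_n) : R :=
  Num.sqrt (mapped_metric k S xi' xi').

(* Main.v *)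
Require Import Defs.
From mathcomp Require Import all_boot all_order all_algebra.
From mathcomp Require Import boolp classical_sets functions reals.
From mathcomp Require Import complex.

(** Both maps have the form [xi |-> F^-1 xi F^-T] for a factor [F] of the base
    point, [S = F F^T]: the symmetric square root or the Cholesky factor.  Such
    a map is a bijection from symmetric matrices to symmetric matrices, with
    inverse [v |-> F v F^T], and by cyclicity of the trace it turns the metric
    at [S] into the Frobenius product [tr (v w)], which no longer mentions [S]
    ([metric_mapping]).  In these coordinates the transport
    [xi |-> F2 (F1^-1 xi F1^-T) F2^T] reads [v |-> v] ([transportE]), and the
    adjoint of the identity for a fixed nondegenerate form is again the
    identity ([mapping_adjoint]).  Preservation of inner products and lengths
    follows because the Frobenius product is the same at both points.

    The substance is that the two factors exist.  For the square root, the
    complex spectral theorem diagonalizes [S], with eigenvalues that are real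
    because [S] is symmetric and positive because [S] is positive definite.
    Real interpolation gives a real polynomial [p] sending each eigenvalue to
    its fourth root; then [T = p(S)] is a real symmetric matrix with
    [T^4 = S], so [T^2 = T T^T] is the wanted positive definite root.  Taking a
    polynomial in [S] keeps the root real, and taking a fourth root makes its
    positivity automatic.  The Cholesky factor is obtained by induction on the
    size, through the Schur complement of the upper left entry, which is a
    congruence of [S] and thus positive definite. *)

Set Implicit Arguments.
Unset Strict Implicit.
Unset Printing Implicit Defensive.
Import Order.TTheory GRing.Theory Num.Theory.
Local Open Scope ring_scope.

(** * Positive definite matrices *)

Lemma symmetricmxP (R : fieldType) n (A : 'M[R]_n) :
  reflect (A^T = A) (A \is symmetricmx).
Proof.
rewrite is_hermitianmxE expr0 scale1r map_mx_id // eq_sym.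
exact: eqP.
Qed.

Lemma mul_trmx_gt0 (R : realDomainType) n (x : 'cV[R]_n) :
  x != 0 -> 0 < (x^T *m x) 0 0.
Proof.
move=> x_neq0; rewrite mxE lt_def; apply/andP; split; last first.
  by apply: sumr_ge0 => i _; rewrite mxE -expr2 sqr_ge0.
apply: contra x_neq0; rewrite psumr_eq0 => [/allP sq0|i _]; last first.
  by rewrite mxE -expr2 sqr_ge0.
apply/eqP/colP => i; rewrite mxE; apply/eqP.
by have := sq0 i (mem_index_enum i); rewrite mxE -expr2 sqrf_eq0.
Qed.

(** [tr (A A^T)] is the sum of the squares of the entries of [A]. *)
Lemma trace_mul_trmx_eq0 (R : realDomainType) n (A : 'M[R]_n) :
  \tr (A *m A^T) = 0 -> A = 0.
Proof.
have ge0 (i j : 'I_n) : 0 <= A i j * A^T j i.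
  by rewrite mxE -expr2 sqr_ge0.
rewrite /mxtrace; under eq_bigr do rewrite mxE.
move=> /eqP; rewrite psumr_eq0; last by move=> i _; apply: sumr_ge0.
move=> /allP tr0; apply/matrixP => i j; rewrite mxE; apply/eqP.
have := tr0 i (mem_index_enum i); rewrite /= psumr_eq0 // => /allP sq0.
by have := sq0 j (mem_index_enum j); rewrite mxE -expr2 sqrf_eq0.
Qed.

(** If [v S = a v] then [v S v^T = a (v v^T)], and both [v S v^T] and
    [v v^T] are positive. *)
Lemma eigenvalue_SPD_gt0 (R : realType) n (S : 'M[R]_n) a :
  SPD S -> eigenvalue S a -> 0 < a.
Proof.
move=> [_ S_pos] /eigenvalueP[v vS v_neq0].
have vT_neq0 : v^T != 0 by rewrite trmx_eq0.
have := S_pos _ vT_neq0; rewrite trmxK vS -scalemxAl mxE.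
by have := mul_trmx_gt0 vT_neq0; rewrite trmxK => /pmulr_lgt0 ->.
Qed.

Lemma SPD_unitmx (R : realType) n (S : 'M[R]_n) : SPD S -> S \in unitmx.
Proof.
move=> S_spd; rewrite unitmxE unitfE; apply/det0P => -[v v_neq0 vS0].
suff: eigenvalue S 0 by move=> /(eigenvalue_SPD_gt0 S_spd); rewrite ltxx.
by apply/eigenvalueP; exists v; rewrite ?scale0r.
Qed.

Lemma SPD1 (R : realType) n : SPD (1%:M : 'M[R]_n).
Proof.
split; first by apply/symmetricmxP; rewrite trmx1.
by move=> x; rewrite mulmx1; exact: mul_trmx_gt0.
Qed.

(** The quadratic form of [A S A^T] at [x] is that of [S] at [A^T x], which is
    nonzero because the rows of [A] are independent. *)
Lemma SPD_congruence (R : realType) m n (S : 'M[R]_n) (A : 'M[R]_(m, n)) :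
  SPD S -> row_free A -> SPD (A *m S *m A^T).
Proof.
move=> [/symmetricmxP S_sym S_pos] A_free; split.
  by apply/symmetricmxP; rewrite !trmx_mul trmxK S_sym mulmxA.
move=> x x_neq0.
have -> : x^T *m (A *m S *m A^T) *m x = (A^T *m x)^T *m S *m (A^T *m x).
  by rewrite trmx_mul trmxK !mulmxA.
apply: S_pos; rewrite -trmx_eq0 trmx_mul trmxK.
by rewrite mulmx_free_eq0 // trmx_eq0.
Qed.

(** * The symmetric square root *)

(** Repetitions are allowed in [s], since eigenvalues are listed with
    multiplicity. *)
Lemma poly_interpolation (F : fieldType) (f : F -> F) (s : seq F) :
  exists p : {poly F}, {in s, forall x, p.[x] = f x}.
Proof.
elim: s => [|a s [p pP]]; first by exists 0.
have [a_s|a_s] := boolP (a \in s).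
  by exists p => x; rewrite inE => /predU1P[->|]; exact: pP.
pose q := \prod_(b <- s) ('X - b%:P).
have qE x : (q.[x] == 0) = (x \in s).
  by have := root_prod_XsubC s x; rewrite /root.
exists (p + ((f a - p.[a]) / q.[a]) *: q) => x; rewrite hornerD hornerZ.
rewrite inE => /predU1P[->|x_s].
  by rewrite divfK ?qE // addrC subrK.
by rewrite pP //; have /eqP -> : q.[x] == 0 by [rewrite qE]; rewrite mulr0 addr0.
Qed.

Lemma symmetric_horner_mx (R : fieldType) n (A : 'M[R]_n.+1) p :
  A \is symmetricmx -> horner_mx A p \is symmetricmx.
Proof.
move=> /symmetricmxP A_sym; apply/symmetricmxP.
elim/poly_ind: p => [|p c IHp]; first by rewrite rmorph0 trmx0.
rewrite rmorphD rmorphM /= horner_mx_X horner_mx_C linearD /= tr_scalar_mx.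
by rewrite trmx_mul A_sym IHp; have /= -> := comm_mx_horner p (erefl (A *m A)).
Qed.

(** The [i]-th row of [P] is an eigenvector. *)
Lemma diag_spectrum_eigenvalue (F : fieldType) n (P : 'M[F]_n) (d : 'rV[F]_n) i :
  P \in unitmx -> eigenvalue (invmx P *m diag_mx d *m P) (d 0 i).
Proof.
move=> P_unit; apply/eigenvalueP; exists (row i P).
  rewrite -row_mul -mulmxA mulKVmx // row_mul row_diag_mx -scalemxAl.
  by rewrite -rowE.
rewrite rowE; apply/eqP => /(congr1 (mulmx^~ (invmx P))).
rewrite mulmxK // mul0mx => /matrixP/(_ 0 i)/eqP.
by rewrite !mxE !eqxx oner_eq0.
Qed.

(** The complex diagonalization only serves to check the identity
    [p(S)^4 = S]; the matrix [p(S)] itself is real by construction. *)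
Lemma SPD_sqrt_exists (R : realType) n (S : 'M[R]_n) :
  SPD S -> exists Q, SPD Q /\ Q *m Q = S.
Proof.
case: n S => [|n] S S_spd.
  by exists S; split => //; rewrite [S *m S]flatmx0 [S in RHS]flatmx0.
have [S_sym _] := S_spd.
pose f : {rmorphism R -> R[i]} := real_complex R.
pose Sc : 'M[R[i]]_n.+1 := map_mx f S.
have Sc_herm : Sc \is hermsymmx.
  apply: realsym_hermsym.
    by apply/symmetricmxP; rewrite /Sc map_trmx (symmetricmxP _ S_sym).
  by apply/mxOverP => i j; rewrite mxE complex_real.
have /orthomx_spectralP Sc_eq := hermitian_normalmx Sc_herm.
set P := spectralmx Sc in Sc_eq; set d := spectral_diag Sc in Sc_eq.
have P_unit : P \in unitmx := spectral_unit Sc.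
pose r i := complex.Re (d 0 i).
have rE i : f (r i) = d 0 i.
  by apply: RRe_real; apply: (mxOverP (hermitian_spectral_diag_real Sc_herm)).
have r_gt0 i : 0 < r i.
  apply: (eigenvalue_SPD_gt0 S_spd); rewrite -(eigenvalue_map f).
  by rewrite -/Sc rE Sc_eq diag_spectrum_eigenvalue.
have [p pP] := poly_interpolation (fun x : R => Num.sqrt (Num.sqrt x)) (codom r).
pose T := horner_mx S p.
have T4 : (T *m T) *m (T *m T) = S.
  have -> : (T *m T) *m (T *m T) = horner_mx S (p ^+ 4).
    by rewrite rmorphXn -[LHS]/((T * T) * (T * T)) -!expr2 -exprM.
  apply: (map_mx_inj (f := f)).
  rewrite map_horner_mx /= -/Sc Sc_eq horner_mx_uconjC // horner_mx_diag.
  congr (_ *m diag_mx _ *m _); apply/rowP => i.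
  rewrite mxE -rE horner_map horner_exp pP ?codom_f //.
  (* the nested square roots are fourth roots: the eigenvalues are positive *)
  by rewrite (exprM _ 2 2) !sqr_sqrtr ?sqrtr_ge0 // ltW.
have T_unit : T \in unitmx.
  by have := SPD_unitmx S_spd; rewrite -T4 !unitmx_mul => /andP[/andP[]].
exists (T *m T); split => //.
have T_sym : T^T = T by apply/symmetricmxP/symmetric_horner_mx.
rewrite -[T *m T](congr1 (mulmx T) T_sym) -[X in X *m _](mulmx1 T).
by apply: SPD_congruence; [exact: SPD1 | rewrite row_free_unit].
Qed.

(** * The Cholesky factor *)

(** Writing [S] in blocks as [[a, b^T], [b, C]], a factor is
    [[s, 0], [b / s, L]] with [s^2 = a] and [L L^T = C - b b^T / a]. *)
Lemma SPD_cholesky_exists (R : realType) n (S : 'M[R]_n) : SPD S ->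
  exists L, [/\ is_trig_mx L, forall i, 0 < L i i & L *m L^T = S].
Proof.
elim: n S => [|n IHn] S S_spd.
  exists 0; split; [exact: mx0_is_trig | by case |].
  by rewrite [S]flatmx0 [_ *m _]flatmx0.
have [/symmetricmxP S_sym S_pos] := S_spd.
pose a := S 0 0; pose b : 'cV[R]_n := @dlsubmx _ 1 n 1 n S.
pose C : 'M[R]_n := @drsubmx _ 1 n 1 n S.
have S_eq : S = block_mx a%:M b^T b C :> 'M_(1 + n).
  rewrite -[LHS](@submxK _ 1 n 1 n); congr block_mx.
    by rewrite [LHS]mx11_scalar !mxE; congr (S _ _)%:M; apply: val_inj.
  by rewrite /b -{1}S_sym trmx_dlsub.
have a_gt0 : 0 < a.
  have e_neq0 : delta_mx 0 0 != 0 :> 'cV[R]_n.+1.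
    by apply/negP => /eqP/matrixP/(_ 0 0)/eqP; rewrite !mxE !eqxx oner_eq0.
  by have := S_pos _ e_neq0; rewrite trmx_delta -rowE -colE !mxE.
(* B performs the elimination of the first column: B S B^T is the Schur
   complement of a. *)
pose B : 'M[R]_(n, 1 + n) := row_mx (- a^-1 *: b) 1%:M.
have B_free : row_free B.
  by apply/row_freeP; exists (col_mx 0 1%:M); rewrite mul_row_col mulmx0 add0r mulmx1.
have schurE : B *m (S : 'M_(1 + n)) *m B^T = C - a^-1 *: (b *m b^T).
  rewrite S_eq mul_row_block mul_mx_scalar scalerA mulrN divff ?gt_eqF //.
  rewrite scaleN1r !mul1mx addNr tr_row_mx mul_row_col mul0mx add0r trmx1 mulmx1.
  by rewrite -scalemxAl scaleNr addrC.
have [L [L_trig L_pos LLT]] := IHn _ (SPD_congruence S_spd B_free).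
pose s := Num.sqrt a.
have s_gt0 : 0 < s by rewrite sqrtr_gt0.
have s2 : s * s = a by rewrite -expr2 sqr_sqrtr // ltW.
pose L1 : 'M[R]_(1 + n) := block_mx s%:M 0 (s^-1 *: b) L.
have L1_trig : is_trig_mx L1.
  by rewrite is_trig_block_mx // eqxx L_trig mx11_is_trig.
have L1_pos i : 0 < L1 i i.
  case: (split_ordP i) => j ->; last by rewrite block_mxEdr.
  by rewrite block_mxEul mxE (ord1 j) eqxx.
exists L1; split=> //.
have -> : L1 *m L1^T = block_mx a%:M b^T b C; last by rewrite [RHS]S_eq.
rewrite tr_block_mx mulmx_block LLT schurE.
rewrite !trmx0 !mulmx0 !mul0mx !addr0 tr_scalar_mx -scalar_mxM s2.
rewrite linearZ /= mul_scalar_mx mul_mx_scalar !scalerA divff ?gt_eqF // !scale1r.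
rewrite -scalemxAl -scalemxAr scalerA -invfM s2.
by rewrite addrC subrK.
Qed.

(** * Whitened coordinates *)

Definition factor (R : realType) n (k : mapping_kind) (S : 'M[R]_n) : 'M[R]_n :=
  match k with SquareRoot => sqrtmx S | Cholesky => cholesky S end.

(** The inverse of the mapping at [S]; see [unwhitenK] and [mappingK]. *)
Definition unwhiten (R : realType) n (k : mapping_kind) (S v : 'M[R]_n) :
  'M[R]_n := factor k S *m v *m (factor k S)^T.

Section Whitening.
Variables (R : realType) (n : nat) (k : mapping_kind).
Implicit Types S xi eta v : 'M[R]_n.

Lemma sqrtmxP S : SPD S -> SPD (sqrtmx S) /\ sqrtmx S *m sqrtmx S = S.
Proof. by move=> /SPD_sqrt_exists; exact: xgetPex. Qed.

Lemma choleskyP S : SPD S ->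
  [/\ is_trig_mx (cholesky S), forall i, 0 < cholesky S i i
    & cholesky S *m (cholesky S)^T = S].
Proof. by move=> /SPD_cholesky_exists; exact: xgetPex. Qed.

Lemma trmx_sqrtmx S : SPD S -> (sqrtmx S)^T = sqrtmx S.
Proof. by move=> /sqrtmxP[[/symmetricmxP]]. Qed.

Lemma mul_factor_trmx S : SPD S -> factor k S *m (factor k S)^T = S.
Proof.
move=> S_spd; rewrite /factor; case: k; last by case: (choleskyP S_spd).
by rewrite trmx_sqrtmx //; case: (sqrtmxP S_spd).
Qed.

Lemma factor_unitmx S : SPD S -> factor k S \in unitmx.
Proof.
move=> S_spd; have := SPD_unitmx S_spd.
by rewrite -{1}(mul_factor_trmx S_spd) unitmx_mul => /andP[].
Qed.

(** For the square root the transpose is harmless, the factor being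
    symmetric; this puts both mappings in a common form. *)
Lemma mappingE S xi : SPD S ->
  mapping k S xi = invmx (factor k S) *m xi *m (invmx (factor k S))^T.
Proof.
by move=> S_spd; rewrite /factor; case: k => //=; rewrite trmx_inv trmx_sqrtmx.
Qed.

Lemma transportE S1 S2 xi : SPD S1 -> SPD S2 ->
  transport k S1 S2 xi = unwhiten k S2 (mapping k S1 xi).
Proof.
move=> S1_spd S2_spd; rewrite /unwhiten /factor.
by case: k => /=; rewrite ?trmx_sqrtmx // !mulmxA.
Qed.

Lemma unwhitenK S : SPD S -> cancel (unwhiten k S) (mapping k S).
Proof.
move=> S_spd v; have F_unit := factor_unitmx S_spd.
rewrite mappingE // /unwhiten trmx_inv !mulmxA mulVmx // mul1mx.
by rewrite mulmxK // unitmx_tr.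
Qed.

Lemma mappingK S : SPD S -> cancel (mapping k S) (unwhiten k S).
Proof.
move=> S_spd xi; have F_unit := factor_unitmx S_spd.
rewrite mappingE // /unwhiten trmx_inv !mulmxA mulmxV // mul1mx.
by rewrite mulmxKV // unitmx_tr.
Qed.

Lemma tangent_mapping S xi : SPD S -> tangent xi -> tangent (mapping k S xi).
Proof.
move=> S_spd /symmetricmxP xi_sym; apply/symmetricmxP.
by rewrite mappingE // !trmx_mul trmxK xi_sym mulmxA.
Qed.

Lemma tangent_unwhiten S v : tangent v -> tangent (unwhiten k S v).
Proof.
move=> /symmetricmxP v_sym; apply/symmetricmxP.
by rewrite /unwhiten !trmx_mul trmxK v_sym mulmxA.
Qed.

(** The condition on the right does not depend on [S]: a matrix that is a mapped
    tangent vector at one point is one at every point. *)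
Lemma mapped_tangentE S v : SPD S -> mapped_tangent k S v <-> tangent v.
Proof.
move=> S_spd; split=> [[xi xi_tan <-]|v_tan]; first exact: tangent_mapping.
by exists (unwhiten k S v); [exact: tangent_unwhiten | exact: unwhitenK].
Qed.

Lemma unmappingE S v : SPD S -> tangent v -> unmapping k S v = unwhiten k S v.
Proof.
move=> S_spd v_tan; rewrite /unmapping -{1}(unwhitenK S_spd v) pinvKV //.
  by move=> x y _ _; exact: (can_inj (mappingK S_spd)).
by rewrite inE; exact: tangent_unwhiten.
Qed.

(** [S^-1 = F^-T F^-1], and the trailing [F^-T] moves around the trace. *)
Lemma metric_mapping S xi eta : SPD S ->
  metric S xi eta = \tr (mapping k S xi *m mapping k S eta).
Proof.
move=> S_spd; have F_unit := factor_unitmx S_spd.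
have invS : invmx S = (invmx (factor k S))^T *m invmx (factor k S).
  apply: (can_inj (mulmxK (SPD_unitmx S_spd))); rewrite mulVmx ?SPD_unitmx //.
  rewrite -[X in _ *m X](mul_factor_trmx S_spd) trmx_inv mulmxA mulmxKV //.
  by rewrite mulVmx // unitmx_tr.
rewrite /metric invS !mappingE // !mulmxA.
by rewrite [RHS]mxtrace_mulC !mulmxA.
Qed.

(** The transport back from [S2] to [S1] satisfies the duality, so the adjoint
    is not the default value.  Any [zeta] satisfying it has
    [tr (v (zeta' - eta')) = 0] for all symmetric [v]; the choice
    [v = zeta' - eta'] forces [zeta' = eta']. *)
Lemma mapping_adjoint S1 S2 eta : SPD S1 -> SPD S2 -> tangent eta ->
  mapping k S1 (adjoint_transport k S1 S2 eta) = mapping k S2 eta.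
Proof.
move=> S1_spd S2_spd eta_tan.
set zeta := adjoint_transport k S1 S2 eta.
have [zeta_tan zetaP] : tangent zeta /\ forall xi, tangent xi ->
    metric S1 xi zeta = metric S2 (transport k S1 S2 xi) eta.
  apply: (@xgetPex _ 0 (fun z => tangent z /\ forall xi, tangent xi ->
    metric S1 xi z = metric S2 (transport k S1 S2 xi) eta)).
  exists (transport k S2 S1 eta).
  split; first by rewrite transportE //; apply/tangent_unwhiten/tangent_mapping.
  by move=> xi _; rewrite !metric_mapping // !transportE // !unwhitenK.
apply/eqP; rewrite -subr_eq0; apply/eqP; set v := _ - _.
have v_tan : tangent v.
  apply/symmetricmxP; rewrite linearB /=.
  by rewrite !(symmetricmxP _ (tangent_mapping _ _)).
apply: trace_mul_trmx_eq0; rewrite (symmetricmxP _ v_tan).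
have := zetaP _ (tangent_unwhiten S1 v_tan).
rewrite !metric_mapping // transportE // !unwhitenK // => /eqP.
by rewrite -subr_eq0 -linearB /= -mulmxBr => /eqP.
Qed.

Lemma mapped_metricE S v w : SPD S -> tangent v -> tangent w ->
  mapped_metric k S v w = \tr (v *m w).
Proof.
by move=> ? ? ?; rewrite /mapped_metric metric_mapping // !unmappingE // !unwhitenK.
Qed.

Lemma mapped_transport_id S1 S2 v : SPD S1 -> SPD S2 -> tangent v ->
  mapped_transport k S1 S2 v = v.
Proof.
move=> ? ? ?.
by rewrite /mapped_transport unmappingE // transportE // !unwhitenK.
Qed.

Lemma mapped_adjoint_transport_id S1 S2 v : SPD S1 -> SPD S2 -> tangent v ->
  mapped_adjoint_transport k S1 S2 v = v.
Proof.
move=> ? ? ?; rewrite /mapped_adjoint_transport unmappingE // mapping_adjoint //.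
  exact: unwhitenK.
exact: tangent_unwhiten.
Qed.

End Whitening.

Theorem corollary3 (R : realType) (n : nat) (k : mapping_kind)
    (S1 S2 : 'M[R]_n) (hS1 : SPD S1) (hS2 : SPD S2) :
  ((forall xi', mapped_tangent k S1 xi' ->
      mapped_transport k S1 S2 xi' = xi')
   /\ (forall eta', mapped_tangent k S2 eta' ->
      mapped_adjoint_transport k S1 S2 eta' = eta'))
  /\ ((forall xi' zeta', mapped_tangent k S1 xi' -> mapped_tangent k S1 zeta' ->
      mapped_metric k S2 (mapped_transport k S1 S2 xi')
        (mapped_transport k S1 S2 zeta')
      = mapped_metric k S1 xi' zeta')
   /\ (forall eta' theta', mapped_tangent k S2 eta' ->
      mapped_tangent k S2 theta' ->
      mapped_metric k S1 (mapped_adjoint_transport k S1 S2 eta')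
        (mapped_adjoint_transport k S1 S2 theta')
      = mapped_metric k S2 eta' theta'))
  /\ ((forall xi', mapped_tangent k S1 xi' ->
      mapped_length k S2 (mapped_transport k S1 S2 xi')
      = mapped_length k S1 xi')
   /\ (forall eta', mapped_tangent k S2 eta' ->
      mapped_length k S1 (mapped_adjoint_transport k S1 S2 eta')
      = mapped_length k S2 eta')).
Proof.
have metricE (S S' v w : 'M[R]_n) : SPD S -> SPD S' -> tangent v -> tangent w ->
    mapped_metric k S v w = mapped_metric k S' v w.
  by move=> *; rewrite !mapped_metricE.
split; [|split]; split.
- by move=> v /mapped_tangentE - /(_ hS1) v_tan; exact: mapped_transport_id.
- by move=> v /mapped_tangentE - /(_ hS2) v_tan; exact: mapped_adjoint_transport_id.
- move=> v w /mapped_tangentE - /(_ hS1) v_tan /mapped_tangentE - /(_ hS1) w_tan.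
  by rewrite !mapped_transport_id //; exact: metricE.
- move=> v w /mapped_tangentE - /(_ hS2) v_tan /mapped_tangentE - /(_ hS2) w_tan.
  by rewrite !mapped_adjoint_transport_id //; exact: metricE.
- move=> v /mapped_tangentE - /(_ hS1) v_tan.
  by rewrite /mapped_length mapped_transport_id // (metricE S2 S1).
move=> v /mapped_tangentE - /(_ hS2) v_tan.
by rewrite /mapped_length mapped_adjoint_transport_id // (metricE S1 S2).
Qed.
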